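(* Let $\mathcal{V}$ be a vector space over a field $\mathbb{F}$, let $\mathcal{D}:\mathcal{V}\to\mathcal{V}$ be a linear endomorphism, and let $$P=(\mathcal{D}+\lambda_0)^{p_0}(\mathcal{D}+\lambda_1)^{p_1}\cdots(\mathcal{D}+\lambda_\ell)^{p_\ell}:\mathcal{V}\to\mathcal{V},$$ with $\lambda_0,\ldots,\lambda_\ell\in\mathbb{F}$ mutually distinct and $p_i\in\mathbb{Z}_{\ge1}$. Then there is a canonical and unique direct sum decomposition of the null space $\mathcal{V}_P$ of $P$, $$\mathcal{V}_P=\bigoplus_{i=0}^{\ell}\mathcal{V}_{\lambda_i},$$ where, for each $i$, $\mathcal{V}_{\lambda_i}$ is the solution space (null space) of $(\mathcal{D}+\lambda_i)^{p_i}$. This is executed by a canonical decomposition of the identity on $\mathcal{V}_P$, $$\mathrm{id}_{\mathcal{V}_P}=\sum_{i=0}^{\ell}\operatorname{Proj}_i,$$ where $\operatorname{Proj}_i:\mathcal{V}_P\to\mathcal{V}_{\lambda_i}$, $i=0,\ldots,\ell$, are projections given by $$\operatorname{Proj}_i:=\Big[\prod_{j\neq i,\,0\le j\le\ell}(\mathcal{D}+\lambda_j)^{-p_j}_{\lambda_i}\Big]\Big[\prod_{k\neq i,\,0\le k\le\ell}(\mathcal{D}+\lambda_k)^{p_k}\Big].$$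
   Context: For $j\ne i$, $$(\mathcal{D}+\lambda_j)^{-1}_{\lambda_i}:=(\lambda_j-\lambda_i)^{-1}\Big(1+\frac{\mathcal{D}+\lambda_i}{\lambda_i-\lambda_j}+\cdots+\frac{(\mathcal{D}+\lambda_i)^{p_i-1}}{(\lambda_i-\lambda_j)^{p_i-1}}\Big),$$ and $(\mathcal{D}+\lambda_j)^{-p}_{\lambda_i}$ denotes the $p$-fold composition of $(\mathcal{D}+\lambda_j)^{-1}_{\lambda_i}$. Empty products are the identity. *)

(* Defs.v *)
From HB Require Import structures.
From mathcomp Require Import all_boot all_order all_algebra.

Set Implicit Arguments.
Unset Strict Implicit.
Unset Printing Implicit Defensive.

Import GRing.Theory.
Local Open Scope ring_scope.

Section Operators.
Variables (F : fieldType) (V : lmodType F).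

(* Ordered composition f 0 \o f 1 \o ... over the indices satisfying Q.  V may
   be infinite-dimensional, so operators are plain functions V -> V rather than
   elements of 'End(V). *)
Definition comp_prod n (Q : pred 'I_n) (f : 'I_n -> V -> V) : V -> V :=
  \big[(fun g h : V -> V => g \o h)/idfun]_(i < n | Q i) f i.

Definition null_space (f : V -> V) : {pred V} := [pred v | f v == 0].

Definition shift_op (D : V -> V) (a : F) : V -> V := fun v => D v + a *: v.

(* W is the internal direct sum of the subspaces U i. *)
Definition direct_sum n (W : {pred V}) (U : 'I_n -> {pred V}) : Prop :=
  [/\ submod_closed W,
      forall i, submod_closed (U i),
      forall i, {subset U i <= W} &
      forall v, v \in W ->
        exists! u : {ffun 'I_n -> V},
          (forall i, u i \in U i) /\ v = \sum_(i < n) u i].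

Variables (D : V -> V) (l : nat).
Variables (lam : 'I_l.+1 -> F) (p : 'I_l.+1 -> nat).

Definition factor_op (i : 'I_l.+1) : V -> V :=
  iter (p i) (shift_op D (lam i)).

Definition prod_op : V -> V := comp_prod predT factor_op.

(* (D + lam_j)^-1 on the null space of (D + lam_i)^p_i, as a truncated
   geometric series in (D + lam_i) / (lam_i - lam_j); meant for j != i. *)
Definition local_inv (i j : 'I_l.+1) : V -> V := fun v =>
  (lam j - lam i)^-1 *:
    \sum_(m < p i) ((lam i - lam j) ^+ m)^-1 *: iter m (shift_op D (lam i)) v.

Definition Proj (i : 'I_l.+1) : V -> V :=
  comp_prod (fun j => j != i) (fun j => iter (p j) (local_inv i j))
  \o comp_prod (fun k => k != i) factor_op.

End Operators.

(* Main.v *)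
Require Import Defs.
From HB Require Import structures.
From mathcomp Require Import all_boot all_order all_algebra.

Set Implicit Arguments.
Unset Strict Implicit.
Unset Printing Implicit Defensive.

Import GRing.Theory.
Local Open Scope ring_scope.

(** Every operator in the statement is [q(D)] for an explicit polynomial [q], so
    the claims become congruences in [F[X]].  Put [f_i = (X + lam_i)^(p_i)].  For
    [j != i], the truncated geometric series defining [local_inv] is a polynomial
    [g_ij] with [g_ij * (X + lam_j)] congruent to 1 modulo [f_i]
    ([dvdp_geom_inverse]).  Hence [Proj i] is [e_i(D)], where [e_i], the product
    of the [(g_ij * (X + lam_j))^(p_j)] over [j != i], is congruent to 1 modulo
    [f_i] ([dvdp_idem_poly_sub1]) and visibly to 0 modulo
    every other [f_j] ([dvdp_idem_poly]).  These are the idempotents of the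
    Chinese remainder theorem: since the [f_i] are pairwise coprime, their
    product divides [\sum_i e_i - 1] ([dvdp_sum_idem_poly]), which is the
    decomposition of the identity on the null space of [P(D)].

    Since [Proj i] is the identity on the null space of [f_i(D)] and vanishes on
    the null spaces of the other [f_j(D)], applying it to any decomposition
    [v = \sum_j u_j] with [u_j] killed by [f_j(D)] gives [u_i = Proj i v].  This
    yields uniqueness of both the components and the projections. *)

(** * Polynomials evaluated at an endomorphism *)

Section PolynomialAction.
Variables (F : fieldType) (V : lmodType F) (D : {linear V -> V}).
Implicit Types (q r : {poly F}) (v w : V).

(** The operator [q(D)], as a function on [V] rather than an element of
    ['End(V)], since [V] may be infinite-dimensional. *)
Definition polyact q v : V := \sum_(k < size q) q`_k *: iter k D v.

Lemma polyact_widen q n v :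
  (size q <= n)%N -> polyact q v = \sum_(k < n) q`_k *: iter k D v.
Proof.
move=> le_q_n; rewrite /polyact.
rewrite (big_ord_widen _ (fun k => q`_k *: iter k D v) le_q_n).
rewrite big_mkcond; apply: eq_bigr => k _; case: ltnP => // le_q_k.
by rewrite nth_default // scale0r.
Qed.

Lemma polyact_linear q : linear (polyact q).
Proof.
move=> a v w; rewrite /polyact scaler_sumr -big_split; apply: eq_bigr => k _ /=.
have ->: iter k D (a *: v + w) = a *: iter k D v + iter k D w.
  by elim: (k : nat) => //= m ->; rewrite linearP.
by rewrite scalerDr !scalerA mulrC.
Qed.

HB.instance Definition _ q :=
  GRing.isLinear.Build F V V *:%R (polyact q) (polyact_linear q).

Lemma polyactD q r v : polyact (q + r) v = polyact q v + polyact r v.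
Proof.
have leD := size_polyD q r.
rewrite (polyact_widen _ leD) (polyact_widen _ (leq_maxl (size q) (size r))).
rewrite (polyact_widen _ (leq_maxr (size q) (size r))) -big_split.
by apply: eq_bigr => k _; rewrite coefD scalerDl.
Qed.

Lemma polyactZ a q v : polyact (a *: q) v = a *: polyact q v.
Proof.
rewrite (polyact_widen _ (size_scale_leq a q)) scaler_sumr.
by apply: eq_bigr => k _; rewrite coefZ scalerA.
Qed.

Lemma polyact0 v : polyact 0 v = 0.
Proof. by rewrite /polyact size_poly0 big_ord0. Qed.

Lemma polyact1 v : polyact 1 v = v.
Proof. by rewrite /polyact size_poly1 big_ord1 coefC scale1r. Qed.

Lemma polyactC a v : polyact a%:P v = a *: v.
Proof. by rewrite -[a%:P]mulr1 mul_polyC polyactZ polyact1. Qed.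

Lemma polyactB q r v : polyact (q - r) v = polyact q v - polyact r v.
Proof. by rewrite -[- r]scaleN1r polyactD polyactZ scaleN1r. Qed.

Lemma polyact_sum (I : Type) (s : seq I) (Q : pred I) (q : I -> {poly F}) v :
  polyact (\sum_(i <- s | Q i) q i) v = \sum_(i <- s | Q i) polyact (q i) v.
Proof.
exact: (big_morph (polyact^~ v) (fun q r => polyactD q r v) (polyact0 v)).
Qed.

Lemma polyactMX q v : polyact (q * 'X) v = D (polyact q v).
Proof.
rewrite (@polyact_widen _ (size q).+1); last first.
  by rewrite (leq_trans (size_polyMleq _ _)) // size_polyX addn2.
rewrite big_ord_recl coefMX scale0r add0r linear_sum; apply: eq_bigr => k _.
by rewrite coefMX linearZ.
Qed.

(** Composition of operators is multiplication of polynomials; commutativity of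
    all the operators involved comes for free from that of [{poly F}]. *)
Lemma polyactM q r v : polyact (q * r) v = polyact q (polyact r v).
Proof.
elim/poly_ind: q => [|q a IHq]; first by rewrite mul0r !polyact0.
rewrite mulrDl mul_polyC mulrAC !polyactD polyactZ polyactC.
by rewrite !polyactMX IHq.
Qed.

Lemma iter_polyact q (f : V -> V) n :
  f =1 polyact q -> iter n f =1 polyact (q ^+ n).
Proof.
move=> fE v; elim: n => [|n IHn]; first by rewrite polyact1.
by rewrite iterS IHn fE -polyactM -exprS.
Qed.

Lemma comp_prod_polyact n (Q : pred 'I_n) f (q : 'I_n -> {poly F}) :
  (forall i, f i =1 polyact (q i)) ->
  comp_prod Q f =1 polyact (\prod_(i < n | Q i) q i).
Proof.
move=> fE; apply: (big_ind2 (fun (h : V -> V) r => h =1 polyact r)) => //.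
- by move=> v; rewrite polyact1.
- by move=> h1 r1 h2 r2 h1E h2E v; rewrite /= h2E h1E polyactM.
Qed.

Lemma polyact_dvd_eq0 q r v : q %| r -> polyact q v = 0 -> polyact r v = 0.
Proof. by case/dvdpP=> c ->; rewrite polyactM => ->; rewrite linear0. Qed.

Lemma null_space_submod q (f : V -> V) :
  f =1 polyact q -> submod_closed (null_space f).
Proof.
move=> fE; split=> [|a v w]; rewrite !inE !fE ?linear0 // => /eqP v0 /eqP w0.
by rewrite polyact_linear v0 w0 scaler0 addr0.
Qed.

End PolynomialAction.

(** * Idempotents modulo a product of pairwise coprime powers *)

Section Idempotents.
Variable F : fieldType.

Lemma dvdp_sub1M (f q r : {poly F}) :
  f %| q - 1 -> f %| r - 1 -> f %| q * r - 1.
Proof.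
move=> fq fr; have ->: q * r - 1 = q * (r - 1) + (q - 1).
  by rewrite mulrBr mulr1 addrA subrK.
by rewrite dvdp_addl // dvdp_mull.
Qed.

Lemma dvdp_sub1X (f q : {poly F}) n : f %| q - 1 -> f %| q ^+ n - 1.
Proof.
move=> fq; elim: n => [|n IHn]; first by rewrite subrr dvdp0.
by rewrite exprS dvdp_sub1M.
Qed.

Lemma dvdp_sub1_prod (I : Type) (s : seq I) (Q : pred I) (f : {poly F}) q :
  (forall i, Q i -> f %| q i - 1) -> f %| \prod_(i <- s | Q i) q i - 1.
Proof.
move=> fq; apply: (big_ind (fun r => f %| r - 1)) => //.
- by rewrite subrr dvdp0.
- by move=> q1 q2; apply: dvdp_sub1M.
Qed.

Lemma dvdp_prod_coprime (I : eqType) (s : seq I) (f : I -> {poly F}) q :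
    uniq s -> (forall i j, i != j -> coprimep (f i) (f j)) ->
  (forall i, f i %| q) -> \prod_(i <- s) f i %| q.
Proof.
move=> + cop fq; elim: s => [|i s IHs] /=; first by rewrite big_nil dvd1p.
case/andP=> s'i /IHs prod_q; rewrite big_cons Gauss_dvdp ?fq //.
rewrite big_seq; apply: (big_ind (coprimep (f i))) => [|q1 q2|j sj].
- exact: coprimep1.
- by rewrite coprimepMr => -> ->.
- by apply: cop; apply: contraNneq s'i => ->.
Qed.

(** The expansion of the inverse of [y - a] in powers of [y / a], truncated
    where the powers of [y] vanish modulo [y ^+ n].  It is used with
    [y = X + lam_i] and [a = lam_i - lam_j], so that [y - a = X + lam_j]. *)
Definition geom_inverse (y : {poly F}) (a : F) n : {poly F} :=
  (- a)^-1 *: \sum_(m < n) (a ^+ m)^-1 *: y ^+ m.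

(** The product is the telescoping one
    [(1 - z) * (1 + z + ... + z ^+ (n - 1)) = 1 - z ^+ n] for [z = y / a]. *)
Lemma dvdp_geom_inverse y a n :
  a != 0 -> y ^+ n %| geom_inverse y a n * (y - a%:P) - 1.
Proof.
move=> a0; pose z := a^-1 *: y.
have zX m : (a ^+ m)^-1 *: y ^+ m = z ^+ m by rewrite exprZn exprVn.
have gE : geom_inverse y a n * (y - a%:P) = 1 - z ^+ n.
  have yE : y - a%:P = a *: (z - 1).
    by rewrite scalerBr scalerA mulfV // scale1r alg_polyC.
  rewrite /geom_inverse yE.
  rewrite (eq_bigr (fun m : 'I_n => z ^+ m)) => [|m _]; last exact: zX.
  rewrite -scalerAl -scalerAr scalerA mulrC invrN mulrN mulfV // scaleN1r.
  by rewrite mulrC -subrX1 opprB.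
by rewrite gE addrAC subrr add0r -zX dvdpNr dvdpZr ?invr_eq0 ?expf_neq0.
Qed.

Variables (l : nat) (lam : 'I_l.+1 -> F) (p : 'I_l.+1 -> nat).
Hypothesis lam_distinct : injective lam.

Definition shift_poly i : {poly F} := 'X + (lam i)%:P.

Definition factor_poly i := shift_poly i ^+ p i.

Definition local_inv_poly i j :=
  geom_inverse (shift_poly i) (lam i - lam j) (p i).

Definition idem_poly i :=
  (\prod_(j < l.+1 | j != i) local_inv_poly i j ^+ p j)
  * \prod_(k < l.+1 | k != i) factor_poly k.

Lemma coprimep_factor_poly i j :
  i != j -> coprimep (factor_poly i) (factor_poly j).
Proof.
move=> neq_ij; apply/coprimep_expl/coprimep_expr.
rewrite /shift_poly -[lam i]opprK -[lam j]opprK !(polyCN (- _)).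
by rewrite coprimep_XsubC2 // opprK addrC subr_eq0 (inj_eq lam_distinct).
Qed.

Lemma dvdp_idem_poly i j : j != i -> factor_poly j %| idem_poly i.
Proof. by move=> neq_ji; rewrite dvdp_mull // (bigD1 j) ?dvdp_mulr. Qed.

Lemma dvdp_idem_poly_sub1 i : factor_poly i %| idem_poly i - 1.
Proof.
rewrite /idem_poly -big_split; apply: dvdp_sub1_prod => j neq_ji /=.
rewrite -exprMn; apply: dvdp_sub1X.
have ->: shift_poly j = shift_poly i - (lam i - lam j)%:P.
  by rewrite /shift_poly polyCB opprB -addrA (addrCA (lam i)%:P) subrr addr0.
by rewrite dvdp_geom_inverse // subr_eq0 (inj_eq lam_distinct) eq_sym.
Qed.

(** Modulo [factor_poly i] only the [i]-th summand survives, and it is 1;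
    coprimality then merges the [l + 1] congruences. *)
Lemma dvdp_sum_idem_poly :
  \prod_i factor_poly i %| \sum_i idem_poly i - 1.
Proof.
apply: dvdp_prod_coprime => [||i]; first exact: index_enum_uniq.
  exact: coprimep_factor_poly.
rewrite (bigD1 i) //= addrAC dvdp_addr ?dvdp_idem_poly_sub1 //.
apply: (big_ind (fun q => factor_poly i %| q)) => [|q1 q2 *|j neq_ji].
- exact: dvdp0.
- by rewrite dvdp_add.
- by rewrite dvdp_idem_poly // eq_sym.
Qed.

Lemma dvdp_factor_idem_poly i :
  \prod_j factor_poly j %| factor_poly i * idem_poly i.
Proof. by rewrite (bigD1 i) //= dvdp_mul // dvdp_mull. Qed.

End Idempotents.

(** * The primary decomposition *)

Section Operators.
Variables (F : fieldType) (V : lmodType F) (D : {linear V -> V}).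
Variables (l : nat) (lam : 'I_l.+1 -> F) (p : 'I_l.+1 -> nat).

Lemma shift_op_polyact i : shift_op D (lam i) =1 polyact D (shift_poly lam i).
Proof.
by move=> v; rewrite polyactD polyactC -['X]mul1r polyactMX polyact1.
Qed.

Lemma factor_op_polyact i :
  factor_op D lam p i =1 polyact D (factor_poly lam p i).
Proof. exact/iter_polyact/shift_op_polyact. Qed.

Lemma prod_op_polyact :
  prod_op D lam p =1 polyact D (\prod_i factor_poly lam p i).
Proof. exact/comp_prod_polyact/factor_op_polyact. Qed.

Lemma local_inv_polyact i j :
  local_inv D lam p i j =1 polyact D (local_inv_poly lam p i j).
Proof.
move=> v; rewrite /local_inv polyactZ polyact_sum opprB; congr (_ *: _).
apply: eq_bigr => m _; rewrite polyactZ; congr (_ *: _).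
exact/iter_polyact/shift_op_polyact.
Qed.

Lemma Proj_polyact i : Proj D lam p i =1 polyact D (idem_poly lam p i).
Proof.
move=> v; rewrite polyactM /Proj /=.
rewrite -(comp_prod_polyact _ factor_op_polyact).
apply: comp_prod_polyact => j.
exact/iter_polyact/local_inv_polyact.
Qed.

End Operators.

Theorem theorem3p4 (F : fieldType) (V : lmodType F) (D : {linear V -> V})
    (l : nat) (lam : 'I_l.+1 -> F) (p : 'I_l.+1 -> nat)
    (lam_distinct : injective lam) (p_ge1 : forall i, (1 <= p i)%N) :
  let VP : {pred V} := null_space (prod_op D lam p) in
  let VL : 'I_l.+1 -> {pred V} := fun i => null_space (factor_op D lam p i) in
  let pr : 'I_l.+1 -> V -> V := Proj D lam p in
  direct_sum VP VL
  /\ (forall i, linear (pr i))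
  /\ (forall i v, v \in VP -> pr i v \in VL i)
  /\ (forall i v, v \in VL i -> pr i v = v)
  /\ (forall i j v, j != i -> v \in VL j -> pr i v = 0)
  /\ (forall v, v \in VP -> v = \sum_(i < l.+1) pr i v)
  /\ (forall Q : 'I_l.+1 -> V -> V,
        (forall i v, v \in VP -> Q i v \in VL i) ->
        (forall v, v \in VP -> v = \sum_(i < l.+1) Q i v) ->
        forall i v, v \in VP -> Q i v = pr i v).
Proof.
move=> VP VL pr.
have prE i : pr i =1 polyact D (idem_poly lam p i) by apply: Proj_polyact.
have VPP v : reflect (polyact D (\prod_i factor_poly lam p i) v = 0) (v \in VP).
  by rewrite inE prod_op_polyact; apply: eqP.
have VLP i v : reflect (polyact D (factor_poly lam p i) v = 0) (v \in VL i).
  by rewrite inE factor_op_polyact; apply: eqP.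
have pr_linear i : linear (pr i) by move=> a v w; rewrite !prE polyact_linear.
have pr_in i v : v \in VP -> pr i v \in VL i.
  move/VPP=> Pv0; apply/VLP; rewrite prE -polyactM.
  by apply: polyact_dvd_eq0 Pv0; apply: dvdp_factor_idem_poly.
have pr_id i v : v \in VL i -> pr i v = v.
  move/VLP=> fv0; apply/eqP; rewrite -subr_eq0 prE.
  rewrite -{2}[v](polyact1 D) -polyactB.
  by apply/eqP/(polyact_dvd_eq0 _ fv0); apply: dvdp_idem_poly_sub1.
have pr_0 i j v : j != i -> v \in VL j -> pr i v = 0.
  move=> neq_ji /VLP fv0; rewrite prE.
  by apply/(polyact_dvd_eq0 _ fv0); apply: dvdp_idem_poly.
have pr_sum v : v \in VP -> v = \sum_i pr i v.
  move/VPP=> Pv0; apply/eqP; rewrite eq_sym -subr_eq0.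
  rewrite (eq_bigr _ (fun i _ => prE i v)).
  rewrite -polyact_sum -{2}[v](polyact1 D) -polyactB.
  by apply/eqP/(polyact_dvd_eq0 _ Pv0); apply: dvdp_sum_idem_poly.
(* The i-th component of any decomposition is recovered by applying [pr i]; both
   uniqueness claims are instances of this. *)
have pr_component (u : 'I_l.+1 -> V) i :
    (forall j, u j \in VL j) -> pr i (\sum_j u j) = u i.
  move=> VLu; rewrite prE linear_sum (bigD1 i) //= -prE pr_id // big1 ?addr0 //.
  by move=> j neq_ji; rewrite -prE (pr_0 i j).
have pr_unique (Q : 'I_l.+1 -> V -> V) :
    (forall i v, v \in VP -> Q i v \in VL i) ->
    (forall v, v \in VP -> v = \sum_i Q i v) ->
    forall i v, v \in VP -> Q i v = pr i v.
  move=> VLQ sumQ i v VPv; rewrite {2}(sumQ v) // pr_component // => j.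
  exact: VLQ.
suff dsum : direct_sum VP VL by split.
split.
- exact: null_space_submod (prod_op_polyact _ _ _).
- by move=> i; apply: null_space_submod (factor_op_polyact _ _ _ i).
- move=> i v /VLP fv0; apply/VPP; apply: polyact_dvd_eq0 fv0.
  by rewrite (bigD1 i) // dvdp_mulr.
- move=> v VPv; exists [ffun i => pr i v]; split.
    split=> [i|]; first by rewrite ffunE pr_in.
    by under eq_bigr do rewrite ffunE; apply: pr_sum.
  by move=> u [VLu ->]; apply/ffunP=> i; rewrite ffunE pr_component.
Qed.
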